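(* Let $\mathcal A$, $\mathcal B$ be idempotent $^*$-algebras over $\mathsf C$ and let $\mathfrak X$ be a $(\mathcal B$-$\mathcal A)$-equivalence bimodule. Then the lattices of closed $^*$-ideals of $\mathcal A$ and of $\mathcal B$ are isomorphic via $\Phi_{\mathfrak X}$ and $\Phi_{\overline{\mathfrak X}}$ (i.e. these maps restrict to mutually inverse lattice isomorphisms between the lattices of closed $^*$-ideals).
   Context: $\mathsf R$ is an ordered ring: an associative commutative ring with $1\neq 0$ and a subset $\mathsf P$ such that $\mathsf R$ is the disjoint union $-\mathsf P\cup\{0\}\cup\mathsf P$ and $\mathsf P+\mathsf P,\ \mathsf P\cdot\mathsf P\subseteq\mathsf P$ (write $a>b$ if $a-b\in\mathsf P$). $\mathsf C=\mathsf R(\mathrm i)$ with $\mathrm i^2=-1$, with the usual conjugation. A $^*$-algebra over $\mathsf C$ is an associative (not necessarily unital) $\mathsf C$-algebra with an antilinear involutive anti-automorphism $^*$; it is idempotent if the products $A_1A_2$ span it. A pre-Hilbert space over $\mathsf C$ is a $\mathsf C$-module $\mathfrak H$ with a positive-definite Hermitian product with values in $\mathsf C$, linear in the second argument; $\mathfrak B(\mathfrak H)$ is the $^*$-algebra of all $A\in\mathrm{End}_{\mathsf C}(\mathfrak H)$ having an adjoint. A $^*$-representation of $\mathcal A$ is a $^*$-homomorphism $\pi:\mathcal A\to\mathfrak B(\mathfrak H)$. A linear functional $\omega:\mathcal A\to\mathsf C$ is positive if $\omega(A^*A)\ge 0$ for all $A$; $\mathcal A^+$ is the set of Hermitian $A\in\mathcal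 A$ with $\omega(A)\ge0$ for all positive $\omega$. All modules carry a compatible $\mathsf C$-module structure. A closed $^*$-ideal of $\mathcal A$ is the kernel of some $^*$-representation of $\mathcal A$ on a pre-Hilbert space over $\mathsf C$. Closed $^*$-ideals form a lattice ordered by inclusion, with $\mathcal I\wedge\mathcal J=\mathcal I\cap\mathcal J$ and $\mathcal I\vee\mathcal J$ the smallest closed $^*$-ideal containing $\mathcal I\cup\mathcal J$. Inner products. For a right $\mathcal A$-module $\mathfrak X$, an $\mathcal A$-valued inner product is a map $\langle\cdot,\cdot\rangle_{\mathcal A}:\mathfrak X\times\mathfrak X\to\mathcal A$ that is $\mathsf C$-linear and right $\mathcal A$-linear in the second argument with $\langle x,y\rangle_{\mathcal A}=\langle y,x\rangle_{\mathcal A}^*$. It is positive semi-definite if $\langle x,x\rangle_{\mathcal A}\in\mathcal A^+$ for all $x$, and full if the $\mathsf C$-span of all $\langle x,y\rangle_{\mathcal A}$ is $\mathcal A$. For a left $\mathcal B$-module, ${}_{\mathcal B}\langle\cdot,\cdot\rangle$ is defined analogously with linearity in the first argument. A $(\mathcal B$-$\mathcal A)$-equivalence bimodule is a $(\mathcal B$-$\mathcal A)$-bimodule $\mathfrak X$ with full positive semi-definite inner products $\langle\cdot,\cdot\rangle_{\mathcal A}$ and ${}_{\mathcal B}\langle\cdot,\cdot\rangle$ such that: $\langle B\cdot x,y\rangle_{\mathcal A}=\langle x,B^*\cdot y\rangle_{\mathcal A}$ and ${}_{\mathcal B}\langle x\cdot A,y\rangle={}_{\mathcal B}\langle x,y\cdot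 A^*\rangle$; $x\cdot\langle y,z\rangle_{\mathcal A}={}_{\mathcal B}\langle x,y\rangle\cdot z$; property P: for every $^*$-representation $(\pi,\mathfrak H)$ of $\mathcal A$ the Hermitian product on $\mathfrak X\otimes_{\mathcal A}\mathfrak H$ determined by $\langle x\otimes\psi,y\otimes\phi\rangle=\langle\psi,\pi(\langle x,y\rangle_{\mathcal A})\phi\rangle_{\mathfrak H}$ is positive semi-definite; property Q: the conjugate $(\mathcal A$-$\mathcal B)$-bimodule $\overline{\mathfrak X}$ (same additive group, elements $\overline x$, with $z\overline x=\overline{\overline zx}$, $A\cdot\overline x=\overline{x\cdot A^*}$, $\overline x\cdot B=\overline{B^*\cdot x}$, $\langle\overline x,\overline y\rangle_{\mathcal B}={}_{\mathcal B}\langle x,y\rangle$) has property P with respect to $\mathcal B$. For a subset $\mathcal I\subseteq\mathcal A$, $\Phi_{\mathfrak X}(\mathcal I)=\{B\in\mathcal B:\langle x,B\cdot y\rangle_{\mathcal A}\in\mathcal I\ \text{for all }x,y\in\mathfrak X\}$; similarly, for $\mathcal J\subseteq\mathcal B$, $\Phi_{\overline{\mathfrak X}}(\mathcal J)=\{A\in\mathcal A:\langle\overline x,A\cdot\overline y\rangle_{\mathcal B}\in\mathcal J\ \text{for all }\overline x,\overline y\in\overline{\mathfrak X}\}$. *)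

(* Defs.v *)
From HB Require Import structures.
From mathcomp Require Import all_boot all_order all_algebra.
From mathcomp Require Import finmap complex.
From mathcomp Require Import all_classical.

Set Implicit Arguments.
Unset Strict Implicit.
Unset Printing Implicit Defensive.

Import Order.TTheory GRing.Theory Num.Theory.

Local Open Scope classical_set_scope.
Local Open Scope ring_scope.

(* An ordered ring has no zero divisors, so [realDomainType] is exactly the   *)
(* class of ordered rings.  [R[i]] carries a ring structure in the library    *)
(* only over a field, hence the alias [cext R] with its own instances.        *)
Definition cext (R : realDomainType) : Type := complex R.

HB.instance Definition _ (R : realDomainType) := GRing.Zmodule.on (cext R).

Section CextRing.
Variable R : realDomainType.
Local Notation C := (cext R).
Implicit Types z w : C.

Definition cone : C := Complex 1 0.

Lemma cext_mul1 : left_id cone (@ComplexField.mulc R).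
Proof. by case=> a b; rewrite /= !mul1r !mul0r subr0 addr0. Qed.

Lemma cext_mulDl : left_distributive (@ComplexField.mulc R) (+%R : C -> C -> C).
Proof.
case=> [a b] [c d] [e f]; rewrite /GRing.add /= !mulrDl !opprD -!addrA.
by congr (Complex (_ + _) (_ + _)); rewrite addrCA.
Qed.

Lemma cone_neq0 : cone != 0 :> C.
Proof. by apply/eqP; case=> /eqP; rewrite oner_eq0. Qed.

HB.instance Definition _ := GRing.Zmodule_isComNzRing.Build C
  (@ComplexField.mulcA R) (@ComplexField.mulcC R) cext_mul1 cext_mulDl cone_neq0.

Definition cconj (z : C) : C := conjc z.

Lemma cconjK : involutive cconj.
Proof. by case=> a b; rewrite /cconj /= opprK. Qed.

Lemma cconj_is_zmod_morphism : zmod_morphism cconj.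
Proof. by case=> [a b] [c d]; rewrite /cconj /GRing.add /GRing.opp /= !opprD. Qed.

Lemma cconj_is_monoid_morphism : monoid_morphism cconj.
Proof.
split; first by rewrite /cconj /GRing.one /= oppr0.
case=> [a b] [c d]; rewrite /cconj /GRing.mul /=.
by rewrite mulrNN mulrN mulNr opprD.
Qed.

HB.instance Definition _ :=
  GRing.isZmodMorphism.Build C C cconj cconj_is_zmod_morphism.
HB.instance Definition _ :=
  GRing.isMonoidMorphism.Build C C cconj cconj_is_monoid_morphism.

Definition cge0 z := (0 <= complex.Re z) && (complex.Im z == 0).
Definition cgt0 z := (0 < complex.Re z) && (complex.Im z == 0).

End CextRing.

Notation "z ^*c" := (cconj z) (at level 2, format "z ^*c") : ring_scope.

HB.mixin Record Lmodule_isStarAlgebra (R : realDomainType) A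
    & GRing.Lmodule (cext R) A := {
  smul : A -> A -> A;
  star : A -> A;
  smulA : associative smul;
  smulDl : left_distributive smul +%R;
  smulDr : right_distributive smul +%R;
  smulZl : forall (z : cext R) (a b : A), smul (z *: a) b = z *: smul a b;
  smulZr : forall (z : cext R) (a b : A), smul a (z *: b) = z *: smul a b;
  starK : involutive star;
  starD : {morph star : a b / a + b};
  starZ : forall (z : cext R) (a : A), star (z *: a) = z^*c *: star a;
  starM : forall a b : A, star (smul a b) = smul (star b) (star a)
}.

#[short(type="starAlgType")]
HB.structure Definition StarAlgebra (R : realDomainType) :=
  { A of Lmodule_isStarAlgebra R A & GRing.Lmodule (cext R) A }.

Notation "a ** b" := (smul a b) (at level 40, left associativity) : ring_scope.
Notation "a ^*s" := (star a) (at level 2, format "a ^*s") : ring_scope.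

HB.mixin Record Lmodule_isPreHilbert (R : realDomainType) H
    & GRing.Lmodule (cext R) H := {
  hdot : H -> H -> cext R;
  hdotDr : forall x y z : H, hdot x (y + z) = hdot x y + hdot x z;
  hdotZr : forall (c : cext R) (x y : H), hdot x (c *: y) = c * hdot x y;
  hdotC : forall x y : H, hdot x y = (hdot y x)^*c;
  hdot_gt0 : forall x : H, x != 0 -> cgt0 (hdot x x)
}.

#[short(type="preHilbertType")]
HB.structure Definition PreHilbert (R : realDomainType) :=
  { H of Lmodule_isPreHilbert R H & GRing.Lmodule (cext R) H }.

Section PreHilbertTheory.
Context {R : realDomainType} {H : preHilbertType R}.
Implicit Types (x y z : H) (c : cext R).

Lemma hdotDl x y z : hdot (x + y) z = hdot x z + hdot y z.
Proof. by rewrite hdotC hdotDr rmorphD /= -!hdotC. Qed.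

Lemma hdotZl c x y : hdot (c *: x) y = c^*c * hdot x y.
Proof. by rewrite hdotC hdotZr rmorphM /= -hdotC. Qed.

Lemma hdot0r x : hdot x 0 = 0.
Proof. by rewrite -(scale0r 0) hdotZr mul0r. Qed.

Lemma hdot0l x : hdot 0 x = 0.
Proof. by rewrite hdotC hdot0r rmorph0. Qed.

Lemma hdot_eq0 x : hdot x x = 0 -> x = 0.
Proof.
move=> x0; apply/eqP/negP => /negP /hdot_gt0.
by rewrite x0 /cgt0 /= ltxx.
Qed.

Lemma hdot_injr x y : (forall z, hdot z x = hdot z y) -> x = y.
Proof.
move=> xy; apply/eqP; rewrite -subr_eq0; apply/eqP/hdot_eq0.
by rewrite hdotDr xy -hdotDr subrr hdot0r.
Qed.

Lemma hdot_injl x y : (forall z, hdot x z = hdot y z) -> x = y.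
Proof. by move=> xy; apply: hdot_injr => z; rewrite hdotC xy -hdotC. Qed.

End PreHilbertTheory.

Section Adjointable.
Variables (R : realDomainType) (H : preHilbertType R).
Local Notation C := (cext R).

Definition is_adjoint (f g : H -> H) :=
  forall x y, hdot (g x) y = hdot x (f y).

Record adjointable := Adjointable {
  adj_fun :> H -> H;
  adj_linear : linear adj_fun;
  adj_ex : exists g, is_adjoint adj_fun g
}.

HB.instance Definition _ := gen_eqMixin adjointable.
HB.instance Definition _ := gen_choiceMixin adjointable.

Implicit Types f g h : adjointable.

Lemma adjointable_ext f g : (f =1 g) -> f = g.
Proof.
case: f g => [f fl fe] [g gl ge] /= /funext fg; rewrite -fg in gl ge *.
by congr Adjointable; exact: Prop_irrelevance.
Qed.

Lemma adjointableDr f x y : f (x + y) = f x + f y.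
Proof. by have := adj_linear f 1 x y; rewrite !scale1r. Qed.

Lemma adjointable0 f : f 0 = 0.
Proof. by apply: (addrI (f 0)); rewrite -adjointableDr !addr0. Qed.

Lemma adjointableZr f c x : f (c *: x) = c *: f x.
Proof. by have := adj_linear f c x 0; rewrite adjointable0 !addr0. Qed.

(* A map with an adjoint is automatically linear.                             *)
Lemma is_adjoint_sym (f g : H -> H) : is_adjoint f g -> is_adjoint g f.
Proof. by move=> fg x y; rewrite hdotC -fg -hdotC. Qed.

Lemma is_adjoint_linear (f g : H -> H) : is_adjoint f g -> linear f.
Proof.
move=> fg c x y; apply: hdot_injr => z.
by rewrite -fg !hdotDr !hdotZr !fg.
Qed.

Definition mk_adjointable (f g : H -> H) (fg : is_adjoint f g) : adjointable :=
  Adjointable (is_adjoint_linear fg) (ex_intro _ g fg).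

Definition adj_fun_star f : H -> H := projT1 (cid (adj_ex f)).

Lemma adj_fun_starP f : is_adjoint f (adj_fun_star f).
Proof. exact: projT2 (cid (adj_ex f)). Qed.

Definition adj_star f := mk_adjointable (is_adjoint_sym (adj_fun_starP f)).

Lemma adj_starP f : is_adjoint f (adj_star f).
Proof. exact: adj_fun_starP. Qed.

Lemma is_adjoint_add f g :
  is_adjoint (fun x => f x + g x) (fun x => adj_star f x + adj_star g x).
Proof. by move=> x y; rewrite hdotDl hdotDr !adj_starP. Qed.

Lemma is_adjoint_scale c f :
  is_adjoint (fun x => c *: f x) (fun x => c^*c *: adj_star f x).
Proof. by move=> x y; rewrite hdotZl hdotZr cconjK adj_starP. Qed.

Lemma is_adjoint_comp f g :
  is_adjoint (fun x => f (g x)) (fun x => adj_star g (adj_star f x)).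
Proof. by move=> x y; rewrite !adj_starP. Qed.

Lemma is_adjoint_zero : is_adjoint (fun=> 0) (fun=> 0).
Proof. by move=> x y; rewrite hdot0l hdot0r. Qed.

Definition adj_zero := mk_adjointable is_adjoint_zero.
Definition adj_add f g := mk_adjointable (is_adjoint_add f g).
Definition adj_scale c f := mk_adjointable (is_adjoint_scale c f).
Definition adj_opp f := adj_scale (- 1) f.
Definition adj_comp f g := mk_adjointable (is_adjoint_comp f g).

Fact adj_addA : associative adj_add.
Proof. by move=> f g h; apply: adjointable_ext => x /=; rewrite addrA. Qed.

Fact adj_addC : commutative adj_add.
Proof. by move=> f g; apply: adjointable_ext => x /=; rewrite addrC. Qed.

Fact adj_add0 : left_id adj_zero adj_add.
Proof. by move=> f; apply: adjointable_ext => x /=; rewrite add0r. Qed.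

Fact adj_addN : left_inverse adj_zero adj_opp adj_add.
Proof.
by move=> f; apply: adjointable_ext => x /=; rewrite scaleN1r addNr.
Qed.

HB.instance Definition _ := GRing.isZmodule.Build adjointable
  adj_addA adj_addC adj_add0 adj_addN.

Fact adj_scaleA a b f : adj_scale a (adj_scale b f) = adj_scale (a * b) f.
Proof. by apply: adjointable_ext => x /=; rewrite scalerA. Qed.

Fact adj_scale1 : left_id 1 adj_scale.
Proof. by move=> f; apply: adjointable_ext => x /=; rewrite scale1r. Qed.

Fact adj_scaleDr : right_distributive adj_scale +%R.
Proof. by move=> a f g; apply: adjointable_ext => x /=; rewrite scalerDr. Qed.

Fact adj_scaleDl f : {morph adj_scale^~ f : a b / a + b}.
Proof. by move=> a b; apply: adjointable_ext => x /=; rewrite scalerDl. Qed.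

HB.instance Definition _ := GRing.Zmodule_isLmodule.Build C adjointable
  adj_scaleA adj_scale1 adj_scaleDr adj_scaleDl.

Fact adj_compA : associative adj_comp.
Proof. by move=> f g h; apply: adjointable_ext. Qed.

Fact adj_compDl : left_distributive adj_comp +%R.
Proof. by move=> f g h; apply: adjointable_ext. Qed.

Fact adj_compDr : right_distributive adj_comp +%R.
Proof. by move=> f g h; apply: adjointable_ext => x /=; rewrite adjointableDr. Qed.

Fact adj_compZl c f g : adj_comp (c *: f) g = c *: adj_comp f g.
Proof. by apply: adjointable_ext. Qed.

Fact adj_compZr c f g : adj_comp f (c *: g) = c *: adj_comp f g.
Proof. by apply: adjointable_ext => x /=; rewrite adjointableZr. Qed.

Lemma adj_star_uniq f g : is_adjoint f g -> adj_star f = g.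
Proof.
move=> fg; apply: adjointable_ext => x; apply: hdot_injl => y.
by rewrite adj_starP fg.
Qed.

Fact adj_starK : involutive adj_star.
Proof. by move=> f; apply: adj_star_uniq; apply/is_adjoint_sym/adj_starP. Qed.

Fact adj_starD : {morph adj_star : f g / f + g}.
Proof. by move=> f g; apply: adj_star_uniq; exact: is_adjoint_add. Qed.

Fact adj_starZ c f : adj_star (c *: f) = c^*c *: adj_star f.
Proof. by apply: adj_star_uniq; exact: is_adjoint_scale. Qed.

Fact adj_starM f g : adj_star (adj_comp f g) = adj_comp (adj_star g) (adj_star f).
Proof. by apply: adj_star_uniq; exact: is_adjoint_comp. Qed.

HB.instance Definition _ := Lmodule_isStarAlgebra.Build R adjointable
  adj_compA adj_compDl adj_compDr adj_compZl adj_compZr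
  adj_starK adj_starD adj_starZ adj_starM.

End Adjointable.

Notation "''B' ( H )" := (adjointable H) (at level 8, format "''B' ( H )").

Record starHom (R : realDomainType) (A B : starAlgType R) := StarHom {
  shom_fun :> {linear A -> B};
  shomM : {morph shom_fun : a b / a ** b};
  shomS : {morph shom_fun : a / a^*s}
}.

Definition starRep (R : realDomainType) (A : starAlgType R)
  (H : preHilbertType R) := starHom A 'B(H).

Section StarAlgebraNotions.
Variables (R : realDomainType).
Local Notation C := (cext R).

Definition cspan (V : lmodType C) (S : set V) : set V :=
  [set v | exists2 s : seq (C * V), (forall p, p \in s -> S p.2) &
                                    v = \sum_(p <- s) p.1 *: p.2].

Variable A : starAlgType R.

Definition idempotent_alg := cspan [set a ** b | a in @setT A & b in @setT A] = setT.

Definition positive_functional (w : {scalar A}) :=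
  forall a, cge0 (w (a^*s ** a)).

Definition positive_elements : set A :=
  [set a | a^*s = a /\ forall w, positive_functional w -> cge0 (w a)].

Definition closed_star_ideal (I : set A) :=
  exists (H : preHilbertType R) (pi : starRep A H), I = [set a | pi a = 0].

End StarAlgebraNotions.

Section DirectSum.
Variables (R : realDomainType) (T : choiceType) (H : T -> preHilbertType R).
Local Notation C := (cext R).

Record dsum := Dsum {
  dsum_fun :> forall k, H k;
  dsum_finite : finite_set [set k | dsum_fun k != 0]
}.

HB.instance Definition _ := gen_eqMixin dsum.
HB.instance Definition _ := gen_choiceMixin dsum.

Implicit Types f g h : dsum.

Lemma dsum_ext f g : (forall k, f k = g k) -> f = g.
Proof.
case: f g => [f ff] [g gf] /= fg.
have {}fg : f = g by apply: functional_extensionality_dep.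
by rewrite -fg in gf *; congr Dsum; exact: Prop_irrelevance.
Qed.

Fact dsum_zero_finite : finite_set [set k | (0 : H k) != 0].
Proof. by rewrite (_ : mkset _ = set0) //; apply/seteqP; split=> k //=; rewrite eqxx. Qed.

Fact dsum_add_finite f g : finite_set [set k | f k + g k != 0].
Proof.
apply: (@sub_finite_set _ _ ([set k | f k != 0] `|` [set k | g k != 0])).
  move=> k /=; have [->|] := eqVneq (f k) 0; last by left.
  by rewrite add0r; right.
by rewrite finite_setU; split; exact: dsum_finite.
Qed.

Fact dsum_map_finite f (u : forall k, H k -> H k) : (forall k, u k 0 = 0) ->
  finite_set [set k | u k (f k) != 0].
Proof.
move=> u0; apply: sub_finite_set (dsum_finite f) => k /=.
by apply: contra_neq => ->; rewrite u0.
Qed.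

Definition dsum_map (u : forall k, H k -> H k) (u0 : forall k, u k 0 = 0) f :=
  Dsum (dsum_map_finite f u0).
Definition dsum_zero := Dsum dsum_zero_finite.
Definition dsum_add f g := Dsum (dsum_add_finite f g).
Definition dsum_scale c f :=
  @dsum_map (fun k x => c *: x) (fun k => scaler0 _ c) f.
Definition dsum_opp f := dsum_scale (-1) f.

Fact dsum_addA : associative dsum_add.
Proof. by move=> f g h; apply: dsum_ext => x /=; rewrite addrA. Qed.

Fact dsum_addC : commutative dsum_add.
Proof. by move=> f g; apply: dsum_ext => x /=; rewrite addrC. Qed.

Fact dsum_add0 : left_id dsum_zero dsum_add.
Proof. by move=> f; apply: dsum_ext => x /=; rewrite add0r. Qed.

Fact dsum_addN : left_inverse dsum_zero dsum_opp dsum_add.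
Proof. by move=> f; apply: dsum_ext => x /=; rewrite scaleN1r addNr. Qed.

HB.instance Definition _ := GRing.isZmodule.Build dsum
  dsum_addA dsum_addC dsum_add0 dsum_addN.

Fact dsum_scaleA a b f : dsum_scale a (dsum_scale b f) = dsum_scale (a * b) f.
Proof. by apply: dsum_ext => x /=; rewrite scalerA. Qed.

Fact dsum_scale1 : left_id 1 dsum_scale.
Proof. by move=> f; apply: dsum_ext => x /=; rewrite scale1r. Qed.

Fact dsum_scaleDr : right_distributive dsum_scale +%R.
Proof. by move=> a f g; apply: dsum_ext => x /=; rewrite scalerDr. Qed.

Fact dsum_scaleDl f : {morph dsum_scale^~ f : a b / a + b}.
Proof. by move=> a b; apply: dsum_ext => x /=; rewrite scalerDl. Qed.

HB.instance Definition _ := GRing.Zmodule_isLmodule.Build C dsum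
  dsum_scaleA dsum_scale1 dsum_scaleDr dsum_scaleDl.

Definition dsum_dot f g : C := \sum_(k \in [set: T]) hdot (f k) (g k).

Lemma dsum_dotE (A : set T) f g : finite_set A ->
  [set k | f k != 0] `<=` A \/ [set k | g k != 0] `<=` A ->
  dsum_dot f g = \sum_(k <- fset_set A) hdot (f k) (g k).
Proof.
move=> finA sub; rewrite /dsum_dot -fsbig_finite//; apply/esym/fsbig_widen => //.
move=> k [_ /= nAk].
case: sub => sub; [have -> : f k = 0|have -> : g k = 0].
- by apply/eqP; apply: contra_notT nAk => /sub.
- by rewrite hdot0l.
- by apply/eqP; apply: contra_notT nAk => /sub.
- by rewrite hdot0r.
Qed.

Fact dsum_dotDr f g h : dsum_dot f (g + h) = dsum_dot f g + dsum_dot f h.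
Proof.
rewrite !(@dsum_dotE _ f _ (dsum_finite f)); [|by left..].
by rewrite -big_split; apply: eq_bigr => k _; exact: hdotDr.
Qed.

Fact dsum_dotZr c f g : dsum_dot f (c *: g) = c * dsum_dot f g.
Proof.
rewrite !(@dsum_dotE _ f _ (dsum_finite f)); [|by left..].
by rewrite big_distrr; apply: eq_bigr => k _; exact: hdotZr.
Qed.

Fact dsum_dotC f g : dsum_dot f g = (dsum_dot g f)^*c.
Proof.
rewrite (@dsum_dotE _ f g (dsum_finite f)); last by left.
rewrite (@dsum_dotE _ g f (dsum_finite f)); last by right.
by rewrite rmorph_sum; apply: eq_bigr => k _; exact: hdotC.
Qed.

Lemma cge0_sum (I : Type) (s : seq I) (F : I -> C) :
  (forall i, cge0 (F i)) -> cge0 (\sum_(i <- s) F i).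
Proof.
move=> F0; elim/big_rec: _ => [|i z _]; first by rewrite /cge0 /= lexx eqxx.
have := F0 i; case: (F i) z => [a b] [c d]; rewrite /cge0 /=.
by move=> /andP[a0 /eqP->] /andP[c0 /eqP->]; rewrite addr_ge0 //= addr0.
Qed.

Lemma cgt0D (z w : C) : cgt0 z -> cge0 w -> cgt0 (z + w).
Proof.
case: z w => [a b] [c d]; rewrite /cge0 /cgt0 /=.
by move=> /andP[a0 /eqP->] /andP[c0 /eqP->]; rewrite ltr_pwDl //= addr0.
Qed.

Lemma hdot_ge0 (K : preHilbertType R) (x : K) : cge0 (hdot x x).
Proof.
have [->|/hdot_gt0] := eqVneq x 0; first by rewrite hdot0l /cge0 /= lexx eqxx.
by rewrite /cgt0 /cge0 => /andP[/ltW -> ->].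
Qed.

Fact dsum_dot_gt0 f : f != 0 -> cgt0 (dsum_dot f f).
Proof.
move=> f0; have [k fk0] : exists k, f k != 0.
  apply: contrapT => nex; move/eqP: f0; apply; apply: dsum_ext => k.
  by apply/eqP/negP => /negP fk; apply: nex; exists k.
rewrite (@dsum_dotE _ f f (dsum_finite f)); last by left.
rewrite (big_rem k) /=; last by rewrite in_fset_set ?inE//; exact: dsum_finite.
by apply: cgt0D; [exact: hdot_gt0|apply: cge0_sum => i; exact: hdot_ge0].
Qed.

HB.instance Definition _ := Lmodule_isPreHilbert.Build R dsum
  dsum_dotDr dsum_dotZr dsum_dotC dsum_dot_gt0.

Variables (A : starAlgType R) (pi : forall k, starRep A (H k)).

Fact dsum_pi0 a k : pi k a 0 = 0.
Proof. exact: adjointable0. Qed.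

Definition dsum_act (a : A) : dsum -> dsum :=
  @dsum_map (fun k => pi k a) (dsum_pi0 a).

Lemma dsum_act_adjoint a : is_adjoint (dsum_act a) (dsum_act a^*s).
Proof.
move=> f g; rewrite -[LHS]/(dsum_dot _ _) -[RHS]/(dsum_dot _ _).
rewrite /dsum_dot; apply: eq_fsbigr => k _ /=.
by rewrite shomS; exact: adj_starP.
Qed.

Definition dsum_rep_fun a : 'B(dsum) := mk_adjointable (dsum_act_adjoint a).

Fact dsum_rep_linear : linear dsum_rep_fun.
Proof.
by move=> c a b; apply: adjointable_ext => f; apply: dsum_ext => k /=; rewrite linearP.
Qed.

HB.instance Definition _ := GRing.isLinear.Build C A 'B(dsum) *:%R dsum_rep_fun
  dsum_rep_linear.

Fact dsum_repM : {morph dsum_rep_fun : a b / a ** b}.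
Proof.
by move=> a b; apply: adjointable_ext => f; apply: dsum_ext => k /=; rewrite shomM.
Qed.

Fact dsum_repS : {morph dsum_rep_fun : a / a^*s}.
Proof. by move=> a; apply/esym/adj_star_uniq; exact: dsum_act_adjoint. Qed.

Definition dsum_rep : starRep A dsum := @StarHom _ _ 'B(dsum) dsum_rep_fun dsum_repM dsum_repS.

Lemma dsum_rep_ker : [set a | dsum_rep a = 0] = \bigcap_k [set a | pi k a = 0].
Proof.
apply/seteqP; split=> a /= pa0.
  move=> k _ /=; apply: adjointable_ext => x.
  have fin : finite_set [set j | (if pselect (k = j) is left e then ecast j (H j) e x else 0) != 0].
    apply: (@sub_finite_set _ _ [set k]); last exact: finite_set1.
    by move=> j /=; case: pselect => // _; rewrite eqxx.
  have /(congr1 (fun u : 'B(dsum) => u (Dsum fin) k)) := pa0.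
  by rewrite /=; case: pselect => // e; rewrite (Prop_irrelevance e erefl).
by apply: adjointable_ext => f; apply: dsum_ext => k /=; rewrite (pa0 k).
Qed.

End DirectSum.

Section ClosedIdealLattice.
Variables (R : realDomainType) (A : starAlgType R).
Implicit Types (P : set (set A)) (I J K : set A).

Lemma closed_star_ideal_bigcap P :
  P `<=` @closed_star_ideal R A -> closed_star_ideal (\bigcap_(I in P) I).
Proof.
move=> Pcl; pose T := {I : set A | P I}.
pose ex (k : T) := cid (Pcl _ (projT2 k)).
pose T' : choiceType := HB.pack T (gen_eqMixin T) (gen_choiceMixin T).
pose H (k : T') := projT1 (ex k).
pose pi (k : T') : starRep A (H k) := projT1 (cid (projT2 (ex k))).
have piP (k : T') : projT1 k = [set a | pi k a = 0].
  exact: projT2 (cid (projT2 (ex k))).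
exists (dsum H), (dsum_rep pi); rewrite dsum_rep_ker.
apply/seteqP; split=> a.
  by move=> aP k _; rewrite -piP; apply: aP; exact: projT2 k.
by move=> aP I PI; have := aP (exist _ I PI) Logic.I; rewrite -piP.
Qed.

Record closedIdeal := ClosedIdeal {
  ci_set :> set A;
  ci_closed : closed_star_ideal ci_set
}.

Implicit Types X Y Z : closedIdeal.

Lemma closedIdeal_ext X Y : X = Y :> set A -> X = Y.
Proof.
case: X Y => [I Icl] [J Jcl] /= IJ; rewrite -IJ in Jcl *.
by congr ClosedIdeal; exact: Prop_irrelevance.
Qed.

HB.instance Definition _ := gen_eqMixin closedIdeal.
HB.instance Definition _ := gen_choiceMixin closedIdeal.

Fact closed_star_ideal_meet X Y : closed_star_ideal (X `&` Y).
Proof.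
have -> : X `&` Y = \bigcap_(I in [set I | I = X :> set A \/ I = Y :> set A]) I.
  apply/seteqP; split=> [a [aX aY] I [->|->]//|a aI].
  by split; apply: aI; [left|right].
by apply: closed_star_ideal_bigcap => I [->|->]; exact: ci_closed.
Qed.

Fact closed_star_ideal_join X Y : closed_star_ideal
  (\bigcap_(I in [set I | closed_star_ideal I /\ X `|` Y `<=` I]) I).
Proof. by apply: closed_star_ideal_bigcap => I []. Qed.

Definition ci_le X Y : bool := `[< X `<=` Y >].
Definition ci_meet X Y := ClosedIdeal (closed_star_ideal_meet X Y).
Definition ci_join X Y := ClosedIdeal (closed_star_ideal_join X Y).

Fact ci_le_refl : reflexive ci_le.
Proof. by move=> X; exact/asboolP. Qed.

Fact ci_le_anti : antisymmetric ci_le.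
Proof.
move=> X Y /andP[/asboolP XY /asboolP YX].
by apply: closedIdeal_ext; apply/seteqP.
Qed.

Fact ci_le_trans : transitive ci_le.
Proof.
by move=> Y X Z /asboolP XY /asboolP YZ; apply/asboolP; exact: subset_trans YZ.
Qed.

Fact closedIdeal_display : Order.disp_t. Proof. exact. Qed.

HB.instance Definition _ := Order.Le_isPOrder.Build closedIdeal_display
  closedIdeal ci_le_refl ci_le_anti ci_le_trans.

Fact ci_meetP X Y Z : (X <= ci_meet Y Z)%O = (X <= Y)%O && (X <= Z)%O.
Proof.
apply/asboolP/andP => [XYZ|[/asboolP XY /asboolP XZ] a aX].
  by split; apply/asboolP => a /XYZ [].
by split; [exact: XY|exact: XZ].
Qed.

Fact ci_joinP X Y Z : (ci_join X Y <= Z)%O = (X <= Z)%O && (Y <= Z)%O.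
Proof.
apply/asboolP/andP => [XYZ|[/asboolP XZ /asboolP YZ] a].
  by split; apply/asboolP => a aX; apply: XYZ => I [_]; apply; [left|right].
by apply; split; [exact: ci_closed|rewrite subUset].
Qed.

HB.instance Definition _ := Order.POrder_MeetJoin_isLattice.Build
  closedIdeal_display closedIdeal ci_meetP ci_joinP.

Lemma ci_leE X Y : (X <= Y)%O = `[< X `<=` Y >]. Proof. by []. Qed.

Lemma ci_meetE X Y : (X `&` Y)%O = X `&` Y :> set A. Proof. by []. Qed.

Lemma ci_joinE X Y : (X `|` Y)%O =
  \bigcap_(I in [set I | closed_star_ideal I /\ X `|` Y `<=` I]) I :> set A.
Proof. by []. Qed.

End ClosedIdealLattice.

Record right_action (R : realDomainType) (A : starAlgType R)
    (X : lmodType (cext R)) (act : X -> A -> X) : Prop := RightAction {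
  ractA : forall x a b, act (act x a) b = act x (a ** b);
  ractDl : forall x y a, act (x + y) a = act x a + act y a;
  ractDr : forall x a b, act x (a + b) = act x a + act x b;
  ractZl : forall (z : cext R) x a, act (z *: x) a = z *: act x a;
  ractZr : forall (z : cext R) x a, act x (z *: a) = z *: act x a
}.

Record left_action (R : realDomainType) (A : starAlgType R)
    (X : lmodType (cext R)) (act : A -> X -> X) : Prop := LeftAction {
  lactA : forall a b x, act a (act b x) = act (a ** b) x;
  lactDl : forall a b x, act (a + b) x = act a x + act b x;
  lactDr : forall a x y, act a (x + y) = act a x + act a y;
  lactZl : forall (z : cext R) a x, act (z *: a) x = z *: act a x;
  lactZr : forall (z : cext R) a x, act a (z *: x) = z *: act a x
}.

Record rightModule (R : realDomainType) (A : starAlgType R) := RightModule {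
  rmod_car :> lmodType (cext R);
  ract : rmod_car -> A -> rmod_car;
  ractP : right_action ract
}.

Record leftModule (R : realDomainType) (A : starAlgType R) := LeftModule {
  lmod_car :> lmodType (cext R);
  lact : A -> lmod_car -> lmod_car;
  lactP : left_action lact
}.

Section RepModule.
Variables (R : realDomainType) (A : starAlgType R) (H : preHilbertType R).
Variable pi : starRep A H.

Fact rep_left_action : left_action (fun a (x : H) => pi a x).
Proof.
split=> [a b x|a b x|a|z a x|z a].
- by rewrite shomM.
- by rewrite linearD.
- exact: adjointableDr.
- by rewrite linearZ.
- exact: adjointableZr.
Qed.

Definition rep_module : leftModule A := LeftModule rep_left_action.

End RepModule.

Section Tensor.
Variables (R : realDomainType) (A : starAlgType R).
Variables (X : rightModule A) (V : leftModule A).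
Local Notation C := (cext R).

Record balanced (M : lmodType C) (beta : X -> V -> M) : Prop := Balanced {
  balDl : forall x y v, beta (x + y) v = beta x v + beta y v;
  balDr : forall x v w, beta x (v + w) = beta x v + beta x w;
  balZl : forall z x v, beta (z *: x) v = z *: beta x v;
  balZr : forall z x v, beta x (z *: v) = z *: beta x v;
  balA : forall x a v, beta (ract x a) v = beta x (lact a v)
}.

(* [X (x)_A V] consists of the formal sums of elementary tensors, two of them *)
(* being identified when no [A]-balanced [C]-bilinear map separates them.     *)
(* The universal property is proved as [tensor_lift_tens] and                 *)
(* [tensor_lift_uniq] below.                                                  *)
Definition tens_sum := seq (X * V).

HB.instance Definition _ := Choice.on tens_sum.

Definition tens_eval (M : lmodType C) (beta : X -> V -> M) (s : tens_sum) : M :=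
  \sum_(p <- s) beta p.1 p.2.

Definition tens_rel (s t : tens_sum) : bool :=
  `[< forall (M : lmodType C) (beta : X -> V -> M), balanced beta ->
        tens_eval beta s = tens_eval beta t >].

Fact tens_rel_refl : reflexive tens_rel.
Proof. by move=> s; apply/asboolP. Qed.

Fact tens_rel_sym : symmetric tens_rel.
Proof. by move=> s t; apply/asboolP/asboolP => st M b bb; rewrite st. Qed.

Fact tens_rel_trans : transitive tens_rel.
Proof.
by move=> t s u /asboolP st /asboolP tu; apply/asboolP => M b bb; rewrite st// tu.
Qed.

Canonical tens_equiv := EquivRel tens_rel tens_rel_refl tens_rel_sym tens_rel_trans.
Canonical tens_encModRel := defaultEncModRel tens_rel.

Definition tensor := {eq_quot tens_rel}%qT.

HB.instance Definition _ := Choice.on tensor.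

Definition tens_class (s : tens_sum) : tensor := \pi_({eq_quot tens_rel})%qT s.
Definition tens_repr (t : tensor) : tens_sum := repr t.

Lemma tens_reprK t : tens_class (tens_repr t) = t.
Proof. exact: reprK. Qed.

Lemma tens_classP s t : tens_class s = tens_class t <->
  forall (M : lmodType C) (beta : X -> V -> M), balanced beta ->
    tens_eval beta s = tens_eval beta t.
Proof.
split=> [/eqmodP /asboolP|st]; first exact.
by apply/eqmodP/asboolP.
Qed.

Lemma tens_eval_repr (M : lmodType C) (beta : X -> V -> M) s : balanced beta ->
  tens_eval beta (tens_repr (tens_class s)) = tens_eval beta s.
Proof. by have /tens_classP := tens_reprK (tens_class s); apply. Qed.

Definition tens_scale_sum (z : C) (s : tens_sum) : tens_sum :=
  [seq (z *: p.1, p.2) | p <- s].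

Lemma tens_eval_cat (M : lmodType C) (beta : X -> V -> M) (s t : tens_sum) :
  tens_eval beta (s ++ t) = tens_eval beta s + tens_eval beta t.
Proof. exact: big_cat. Qed.

Lemma tens_eval_scale (M : lmodType C) (beta : X -> V -> M) z s :
  balanced beta -> tens_eval beta (tens_scale_sum z s) = z *: tens_eval beta s.
Proof.
move=> bb; rewrite /tens_eval big_map scaler_sumr.
by apply: eq_bigr => p _; rewrite balZl.
Qed.

Definition tens_zero : tensor := tens_class [::].
Definition tens_add (t u : tensor) : tensor :=
  tens_class (tens_repr t ++ tens_repr u).
Definition tens_scale (z : C) (t : tensor) : tensor :=
  tens_class (tens_scale_sum z (tens_repr t)).
Definition tens_opp (t : tensor) : tensor := tens_scale (-1) t.

Lemma tensor_ext (t u : tensor) :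
  (forall (M : lmodType C) (beta : X -> V -> M), balanced beta ->
     tens_eval beta (tens_repr t) = tens_eval beta (tens_repr u)) -> t = u.
Proof. by move=> /tens_classP; rewrite !tens_reprK. Qed.

Lemma tens_eval_add (M : lmodType C) (beta : X -> V -> M) t u : balanced beta ->
  tens_eval beta (tens_repr (tens_add t u)) =
  tens_eval beta (tens_repr t) + tens_eval beta (tens_repr u).
Proof. by move=> bb; rewrite tens_eval_repr// tens_eval_cat. Qed.

Lemma tens_eval_scaler (M : lmodType C) (beta : X -> V -> M) z t : balanced beta ->
  tens_eval beta (tens_repr (tens_scale z t)) = z *: tens_eval beta (tens_repr t).
Proof. by move=> bb; rewrite tens_eval_repr// tens_eval_scale. Qed.

Lemma tens_eval_zero (M : lmodType C) (beta : X -> V -> M) : balanced beta ->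
  tens_eval beta (tens_repr tens_zero) = 0.
Proof. by move=> bb; rewrite tens_eval_repr// /tens_eval big_nil. Qed.

Local Ltac tensor_tac := apply: tensor_ext => M beta bb;
  rewrite /tens_opp ?(tens_eval_add, tens_eval_scaler, tens_eval_zero)//.

Fact tens_addA : associative tens_add.
Proof. by move=> t u v; tensor_tac; rewrite addrA. Qed.

Fact tens_addC : commutative tens_add.
Proof. by move=> t u; tensor_tac; rewrite addrC. Qed.

Fact tens_add0 : left_id tens_zero tens_add.
Proof. by move=> t; tensor_tac; rewrite add0r. Qed.

Fact tens_addN : left_inverse tens_zero tens_opp tens_add.
Proof. by move=> t; tensor_tac; rewrite scaleN1r addNr. Qed.

HB.instance Definition _ := GRing.isZmodule.Build tensor
  tens_addA tens_addC tens_add0 tens_addN.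

Fact tens_scaleA a b t : tens_scale a (tens_scale b t) = tens_scale (a * b) t.
Proof. by tensor_tac; rewrite scalerA. Qed.

Fact tens_scale1 : left_id 1 tens_scale.
Proof. by move=> t; tensor_tac; rewrite scale1r. Qed.

Fact tens_scaleDr : right_distributive tens_scale +%R.
Proof. by move=> a t u; tensor_tac; rewrite scalerDr. Qed.

Fact tens_scaleDl t : {morph tens_scale^~ t : a b / a + b}.
Proof. by move=> a b; tensor_tac; rewrite scalerDl. Qed.

HB.instance Definition _ := GRing.Zmodule_isLmodule.Build C tensor
  tens_scaleA tens_scale1 tens_scaleDr tens_scaleDl.

Definition tens (x : X) (v : V) : tensor := tens_class [:: (x, v)].

Definition tensor_lift (M : lmodType C) (beta : X -> V -> M) (t : tensor) : M :=
  tens_eval beta (tens_repr t).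

Lemma tensor_lift_tens (M : lmodType C) (beta : X -> V -> M) : balanced beta ->
  forall x v, tensor_lift beta (tens x v) = beta x v.
Proof.
by move=> bb x v; rewrite /tensor_lift tens_eval_repr// /tens_eval big_seq1.
Qed.

Lemma tensor_lift_linear (M : lmodType C) (beta : X -> V -> M) :
  balanced beta -> linear (tensor_lift beta).
Proof.
by move=> bb z t u; rewrite /tensor_lift tens_eval_add// tens_eval_scaler.
Qed.

Lemma tens_balanced : balanced tens.
Proof.
by split=> *; apply: tensor_ext => M beta bb;
  rewrite ?(tens_eval_add, tens_eval_scaler)// !tens_eval_repr// /tens_eval
    !big_seq1 /= ?(balDl bb, balDr bb, balZl bb, balZr bb, balA bb).
Qed.

Lemma tens_classE s : tens_class s = \sum_(p <- s) tens p.1 p.2.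
Proof.
elim: s => [|[x v] s IH]; first by rewrite big_nil.
rewrite big_cons /= -IH; apply: tensor_ext => M beta bb.
rewrite tens_eval_add// !tens_eval_repr//.
by rewrite -tens_eval_cat.
Qed.

Lemma tensor_lift_uniq (M : lmodType C) (beta : X -> V -> M)
  (f : {linear tensor -> M}) : balanced beta ->
  (forall x v, f (tens x v) = beta x v) -> f =1 tensor_lift beta.
Proof.
move=> bb fE t; rewrite -(tens_reprK t) tens_classE linear_sum /=.
rewrite -tens_classE /tensor_lift tens_eval_repr//.
by apply: eq_bigr => p _; exact: fE.
Qed.

End Tensor.

Section InnerProducts.
Variables (R : realDomainType) (A : starAlgType R).
Local Notation C := (cext R).

Record right_inner_product (X : rightModule A) (ip : X -> X -> A) : Prop :=
  RightInnerProduct {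
    ripDr : forall x y z, ip x (y + z) = ip x y + ip x z;
    ripZr : forall (c : C) x y, ip x (c *: y) = c *: ip x y;
    ripAr : forall x y a, ip x (ract y a) = ip x y ** a;
    ripC : forall x y, ip x y = (ip y x)^*s
  }.

Record left_inner_product (X : leftModule A) (ip : X -> X -> A) : Prop :=
  LeftInnerProduct {
    lipDl : forall x y z, ip (x + y) z = ip x z + ip y z;
    lipZl : forall (c : C) x y, ip (c *: x) y = c *: ip x y;
    lipAl : forall a x y, ip (lact a x) y = a ** ip x y;
    lipC : forall x y, ip x y = (ip y x)^*s
  }.

Definition pos_semidef (T : Type) (ip : T -> T -> A) :=
  forall x, positive_elements (ip x x).

Definition full (T : Type) (ip : T -> T -> A) :=
  cspan [set ip x y | x in [set: T] & y in [set: T]] = setT.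

End InnerProducts.

Section InducedProduct.
Variables (R : realDomainType) (A : starAlgType R).
Variables (X : rightModule A) (ip : X -> X -> A).
Variables (H : preHilbertType R) (pi : starRep A H).
Local Notation C := (cext R).
Local Notation XH := (tensor X (rep_module pi)).

(* The value does not depend on the representatives: see [induced_dot_tens],  *)
(* [induced_dotDr], [induced_dotZr] and [induced_dotC] below, which           *)
(* characterize the Hermitian product.                                        *)
Definition induced_dot (t u : XH) : C :=
  \sum_(p <- tens_repr t) \sum_(q <- tens_repr u)
    hdot (p.2 : H) (pi (ip p.1 q.1) q.2).

Hypothesis ipP : right_inner_product ip.

Fact induced_balanced (x : X) (v : H) :
  balanced (fun (y : X) (w : rep_module pi) => hdot v (pi (ip x y) w) : C^o).
Proof.
split=> [y z w|y w w'|c y w|c y w|y a w].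
- by rewrite (ripDr ipP) linearD /= hdotDr.
- by rewrite adjointableDr hdotDr.
- by rewrite (ripZr ipP) linearZ /= hdotZr.
- by rewrite adjointableZr hdotZr.
- by rewrite (ripAr ipP) shomM.
Qed.

Lemma induced_hdotC x y (v w : H) :
  hdot v (pi (ip x y) w) = (hdot w (pi (ip y x) v))^*c.
Proof. by rewrite -hdotC (ripC ipP y x) shomS adj_starP. Qed.

Lemma induced_dotC t u : induced_dot t u = (induced_dot u t)^*c.
Proof.
rewrite /induced_dot exchange_big rmorph_sum; apply: eq_bigr => q _.
rewrite rmorph_sum; apply: eq_bigr => p _ /=.
exact: induced_hdotC.
Qed.

Lemma induced_dotDr t u v : induced_dot t (u + v) = induced_dot t u + induced_dot t v.
Proof.
rewrite /induced_dot -big_split; apply: eq_bigr => p _.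
exact: (tens_eval_add _ _ (induced_balanced p.1 p.2)).
Qed.

Lemma induced_dotZr c t u : induced_dot t (c *: u) = c * induced_dot t u.
Proof.
rewrite /induced_dot big_distrr; apply: eq_bigr => p _.
exact: (tens_eval_scaler _ _ (induced_balanced p.1 p.2)).
Qed.

Lemma induced_dot_tens (x y : X) (v w : H) :
  induced_dot (tens (V := rep_module pi) x v) (tens (V := rep_module pi) y w) =
  hdot v (pi (ip x y) w).
Proof.
transitivity (\sum_(p <- tens_repr (tens (V := rep_module pi) x v))
    hdot (p.2 : H) (pi (ip p.1 y) w)).
  apply: eq_bigr => p _.
  exact: (tensor_lift_tens (induced_balanced p.1 p.2) y w).
under eq_bigr => p _ do rewrite induced_hdotC.
rewrite -rmorph_sum [RHS]induced_hdotC; congr (_ ^*c).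
exact: (tensor_lift_tens (induced_balanced y w) x v).
Qed.

End InducedProduct.

Definition propertyP (R : realDomainType) (A : starAlgType R)
    (X : rightModule A) (ip : X -> X -> A) :=
  forall (H : preHilbertType R) (pi : starRep A H) (t : tensor X (rep_module pi)),
    cge0 (induced_dot ip t t).

Record bimodule (R : realDomainType) (B A : starAlgType R) := Bimodule {
  bimod_car :> lmodType (cext R);
  bimod_lact : B -> bimod_car -> bimod_car;
  bimod_ract : bimod_car -> A -> bimod_car;
  bimod_lactP : left_action bimod_lact;
  bimod_ractP : right_action bimod_ract;
  bimod_actA : forall b x a,
    bimod_ract (bimod_lact b x) a = bimod_lact b (bimod_ract x a)
}.

Notation "b *>> x" := (bimod_lact b x) (at level 40, left associativity) : ring_scope.
Notation "x <<* a" := (bimod_ract x a) (at level 40, left associativity) : ring_scope.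

Definition bimod_left (R : realDomainType) (B A : starAlgType R)
  (X : bimodule B A) : leftModule B := LeftModule (bimod_lactP X).

Definition bimod_right (R : realDomainType) (B A : starAlgType R)
  (X : bimodule B A) : rightModule A := RightModule (bimod_ractP X).

Section Conjugate.
Variable R : realDomainType.
Local Notation C := (cext R).

Definition conj_mod (V : lmodType C) : Type := V.

HB.instance Definition _ (V : lmodType C) := GRing.Zmodule.on (conj_mod V).

Section ConjMod.
Variable V : lmodType C.

Definition conj_scale (z : C) (x : conj_mod V) : conj_mod V :=
  z^*c *: (x : V).

Fact conj_scaleA a b x : conj_scale a (conj_scale b x) = conj_scale (a * b) x.
Proof. by rewrite /conj_scale scalerA rmorphM. Qed.

Fact conj_scale1 : left_id 1 conj_scale.
Proof. by move=> x; rewrite /conj_scale rmorph1 scale1r. Qed.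

Fact conj_scaleDr : right_distributive conj_scale +%R.
Proof. by move=> a x y; exact: scalerDr. Qed.

Fact conj_scaleDl x : {morph conj_scale^~ x : a b / a + b}.
Proof. by move=> a b; rewrite /conj_scale rmorphD; exact: scalerDl. Qed.

HB.instance Definition _ := GRing.Zmodule_isLmodule.Build C (conj_mod V)
  conj_scaleA conj_scale1 conj_scaleDr conj_scaleDl.

End ConjMod.

Variables (A B : starAlgType R) (X : bimodule B A).

Definition conj_lact (a : A) (x : conj_mod X) : conj_mod X := (x : X) <<* a^*s.
Definition conj_ract (x : conj_mod X) (b : B) : conj_mod X := b^*s *>> (x : X).

Fact conj_lactP : left_action conj_lact.
Proof.
have rP := bimod_ractP X; rewrite /conj_lact.
split=> [a b x|a b x|a x y|z a x|z a x].
- by rewrite (ractA rP) starM.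
- by rewrite starD (ractDr rP).
- exact: (ractDl rP).
- by rewrite starZ (ractZr rP).
- exact: (ractZl rP).
Qed.

Fact conj_ractP : right_action conj_ract.
Proof.
have lP := bimod_lactP X; rewrite /conj_ract.
split=> [x a b|x y a|x a b|z x a|z x a].
- by rewrite (lactA lP) starM.
- exact: (lactDr lP).
- by rewrite starD (lactDl lP).
- exact: (lactZr lP).
- by rewrite starZ (lactZl lP).
Qed.

Fact conj_actA a x b :
  conj_ract (conj_lact a x) b = conj_lact a (conj_ract x b).
Proof. by rewrite /conj_ract /conj_lact bimod_actA. Qed.

Definition conj_bimodule : bimodule A B :=
  Bimodule conj_lactP conj_ractP conj_actA.

Definition conj_ip (ipB : X -> X -> B) : conj_bimodule -> conj_bimodule -> B :=
  ipB.

End Conjugate.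

Record equivalence_bimodule (R : realDomainType) (B A : starAlgType R)
    (X : bimodule B A) (ipA : X -> X -> A) (ipB : X -> X -> B) : Prop :=
  EquivalenceBimodule {
    eqv_ipA : right_inner_product (X := bimod_right X) ipA;
    eqv_ipB : left_inner_product (X := bimod_left X) ipB;
    eqv_posA : pos_semidef ipA;
    eqv_posB : pos_semidef ipB;
    eqv_fullA : full ipA;
    eqv_fullB : full ipB;
    eqv_adjA : forall b x y, ipA (b *>> x) y = ipA x (b^*s *>> y);
    eqv_adjB : forall x a y, ipB (x <<* a) y = ipB x (y <<* a^*s);
    eqv_compat : forall x y z, x <<* ipA y z = ipB x y *>> z;
    eqv_P : propertyP (X := bimod_right X) ipA;
    eqv_Q : propertyP (X := bimod_right (conj_bimodule X)) (conj_ip ipB)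
  }.

Definition Phi (R : realDomainType) (B A : starAlgType R) (X : bimodule B A)
    (ipA : X -> X -> A) (I : set A) : set B :=
  [set b | forall x y, I (ipA x (b *>> y))].

(* Main.v *)
Require Import Defs.
From HB Require Import structures.
From mathcomp Require Import all_boot all_order all_algebra.
From mathcomp Require Import complex ring.
From mathcomp Require Import all_classical.

(* If [I] is the kernel of a representation [pi] on [H], then [B] acts on the *)
(* pre-Hilbert space obtained from [X (x)_A H] by dividing out the null       *)
(* vectors of the induced product, and this action has kernel [Phi I], since  *)
(* [<x (x) v, b y (x) w> = <v, pi(<x, b y>) w>].                              *)
(* Compatibility of the two inner products turns membership of [a] in the     *)
(* double transform of [I] into [<u, x> a <y, v> \in I] for all [u x y v],    *)
(* hence by fullness into [c a d \in I] for all [c d]; for the kernel of a    *)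
(* representation this forces [a \in I].  The two transforms are monotone and *)
(* mutually inverse, so they preserve meets and joins.                        *)

Set Implicit Arguments.
Unset Strict Implicit.

Import Order.TTheory GRing.Theory Num.Theory.

Local Open Scope classical_set_scope.
Local Open Scope ring_scope.

(** Both transforms come from Rieffel induction. Property P makes the induced product on the tensor
    product of [X] with [H] positive semi-definite. The Cauchy-Schwarz substitute [psd_null] then
    makes the product definite on the quotient by null vectors, and [B] acts there by adjointable
    operators because [ipA] admits adjoints. [induced_rep_ker] computes the kernel, so [Phi ipA]
    preserves closed ideals; property Q gives the same for the conjugate bimodule. That the
    transforms are inverse to each other is algebra: [ipA_ipB] and [ipB_ipA] rewrite the double
    transform as a condition on two-sided products, and [closed_ideal_full] cancels the outer
    factors using fullness and definiteness of the Hilbert product. Monotone inverse bijections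
    respect the lattice operations ([homo_cancel_meet], [homo_cancel_join]). *)

(** * Pre-Hilbert quotients of positive semi-definite forms *)

Record psd_form (R : realDomainType) (V : lmodType (cext R)) := PsdForm {
  psd_dot :> V -> V -> cext R;
  psdDr : forall x y z, psd_dot x (y + z) = psd_dot x y + psd_dot x z;
  psdZr : forall (c : cext R) x y, psd_dot x (c *: y) = c * psd_dot x y;
  psdC : forall x y, psd_dot x y = (psd_dot y x)^*c;
  psd_ge0 : forall x, cge0 (psd_dot x x)
}.

Section NullQuotient.
Variables (R : realDomainType) (V : lmodType (cext R)) (d : psd_form V).
Local Notation C := (cext R).

Lemma psdDl x y z : d (x + y) z = d x z + d y z.
Proof. by rewrite psdC psdDr rmorphD /= -!psdC. Qed.

Lemma psdZl c x y : d (c *: x) y = c^*c * d x y.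
Proof. by rewrite psdC psdZr rmorphM /= -psdC. Qed.

Lemma psd0r x : d x 0 = 0.
Proof. by rewrite -(scale0r 0) psdZr mul0r. Qed.

(* With [w = d y x] and [p = d y y], positivity is tested on the vector       *)
(* [|w|^2 y - (p + 1) w^* x], which avoids dividing by [p] or [|w|^2].        *)
Lemma psd_null x : d x x = 0 -> forall y, d y x = 0.
Proof.
move=> dx0 y; set w := d y x; set p := d y y.
have := psd_ge0 d ((w^*c * w) *: y + (- ((p + 1) * w^*c)) *: x).
rewrite psdDr !psdDl !psdZr !psdZl dx0 (psdC d x y) -/w -/p.
have := psd_ge0 d y; rewrite -/p.
case: p w {dx0} => [p p'] [a b].
rewrite /cge0 => /= /andP[p0 /eqP p'0]; subst p'.
move=> /andP[+ _]; set r := (X in 0 <= X).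
(* The shift to [p + 1] in the test vector keeps the factor [p + 2] positive even when [p = 0]. *)
have -> : r = - ((p + 2) * (a ^+ 2 + b ^+ 2) ^+ 2) by rewrite /r; ring.
rewrite oppr_ge0 pmulr_rle0 ?ltr_wpDl// => q0.
have : (a ^+ 2 + b ^+ 2) ^+ 2 = 0 by apply/eqP; rewrite eq_le q0 sqr_ge0.
move/eqP; rewrite expf_eq0 /= paddr_eq0 ?sqr_ge0// !expf_eq0 /=.
by case/andP=> /eqP-> /eqP->.
Qed.

(** By [psd_null] this amounts to [x - y] being a null vector; in this form an equation between
    classes is checked by pairing with every [z]. *)
Definition null_rel (x y : V) : bool := `[< forall z, d z x = d z y >].

Fact null_rel_refl : reflexive null_rel.
Proof. by move=> x; apply/asboolP. Qed.

Fact null_rel_sym : symmetric null_rel.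
Proof. by move=> x y; apply/asboolP/asboolP => xy z; rewrite xy. Qed.

Fact null_rel_trans : transitive null_rel.
Proof.
by move=> y x z /asboolP xy /asboolP yz; apply/asboolP => t; rewrite xy.
Qed.

Canonical null_equiv := EquivRel null_rel null_rel_refl null_rel_sym null_rel_trans.
Canonical null_encModRel := defaultEncModRel null_rel.

Definition null_quot := {eq_quot null_rel}%qT.

HB.instance Definition _ := Choice.on null_quot.

Definition nclass (x : V) : null_quot := \pi_({eq_quot null_rel})%qT x.
Definition nrepr (q : null_quot) : V := repr q.

Lemma nreprK q : nclass (nrepr q) = q.
Proof. exact: reprK. Qed.

Lemma nclassP x y : nclass x = nclass y <-> forall z, d z x = d z y.
Proof.
split=> [/eqmodP /asboolP|xy]; first exact.
by apply/eqmodP/asboolP.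
Qed.

Lemma nrepr_class z x : d z (nrepr (nclass x)) = d z x.
Proof. by have /nclassP := nreprK (nclass x); apply. Qed.

Definition nquot_dot (q r : null_quot) : C := d (nrepr q) (nrepr r).

Lemma nquot_ext q r : (forall z, d z (nrepr q) = d z (nrepr r)) -> q = r.
Proof. by move/nclassP; rewrite !nreprK. Qed.

Definition nquot_zero := nclass 0.
Definition nquot_add q r := nclass (nrepr q + nrepr r).
Definition nquot_scale (c : C) q := nclass (c *: nrepr q).
Definition nquot_opp q := nquot_scale (-1) q.

Local Ltac nquot_tac := apply: nquot_ext => ?;
  rewrite /nquot_opp !(nrepr_class, psdDr, psdZr, psd0r).

Fact nquot_addA : associative nquot_add.
Proof. by move=> q r s; nquot_tac; rewrite addrA. Qed.

Fact nquot_addC : commutative nquot_add.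
Proof. by move=> q r; nquot_tac; rewrite addrC. Qed.

Fact nquot_add0 : left_id nquot_zero nquot_add.
Proof. by move=> q; nquot_tac; rewrite add0r. Qed.

Fact nquot_addN : left_inverse nquot_zero nquot_opp nquot_add.
Proof. by move=> q; nquot_tac; rewrite mulN1r addNr. Qed.

HB.instance Definition _ := GRing.isZmodule.Build null_quot
  nquot_addA nquot_addC nquot_add0 nquot_addN.

Fact nquot_scaleA a b q : nquot_scale a (nquot_scale b q) = nquot_scale (a * b) q.
Proof. by nquot_tac; rewrite mulrA. Qed.

Fact nquot_scale1 : left_id 1 nquot_scale.
Proof. by move=> q; nquot_tac; rewrite mul1r. Qed.

Fact nquot_scaleDr : right_distributive nquot_scale +%R.
Proof. by move=> a q r; nquot_tac; rewrite mulrDr. Qed.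

Fact nquot_scaleDl q : {morph nquot_scale^~ q : a b / a + b}.
Proof. by move=> a b; nquot_tac; rewrite mulrDl. Qed.

HB.instance Definition _ := GRing.Zmodule_isLmodule.Build C null_quot
  nquot_scaleA nquot_scale1 nquot_scaleDr nquot_scaleDl.

Fact nquot_dotDr q r s : nquot_dot q (r + s) = nquot_dot q r + nquot_dot q s.
Proof. by rewrite /nquot_dot nrepr_class psdDr. Qed.

Fact nquot_dotZr c q r : nquot_dot q (c *: r) = c * nquot_dot q r.
Proof. by rewrite /nquot_dot nrepr_class psdZr. Qed.

Fact nquot_dotC q r : nquot_dot q r = (nquot_dot r q)^*c.
Proof. exact: psdC. Qed.

Fact nquot_dot_gt0 q : q != 0 -> cgt0 (nquot_dot q q).
Proof.
move=> q0; have := psd_ge0 d (nrepr q); rewrite -/(nquot_dot q q).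
(* Definiteness: by [psd_null] a class of length zero pairs to zero with everything. *)
have dq0 : nquot_dot q q != 0.
  apply: contra_neq q0 => dq0; apply: nquot_ext => z.
  by rewrite nrepr_class psd0r psd_null.
case: (nquot_dot q q) dq0 => a b ab /andP[/= a0 /eqP b0]; subst b.
rewrite /cgt0 /= eqxx andbT lt_neqAle a0 andbT.
by apply: contra_neq ab => <-.
Qed.

HB.instance Definition _ := Lmodule_isPreHilbert.Build R null_quot
  nquot_dotDr nquot_dotZr nquot_dotC nquot_dot_gt0.

Variables (B : starAlgType R) (L : B -> V -> V).
Hypotheses (L_linear : forall c a b x, L (c *: a + b) x = c *: L a x + L b x)
  (LM : forall a b x, L (a ** b) x = L a (L b x))
  (L_adjoint : forall b x y, d (L b^*s x) y = d x (L b y)).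

Definition nquot_act b (q : null_quot) : null_quot := nclass (L b (nrepr q)).

(** The action descends to classes: once [L b] is moved to the other side, the representative stands
    where only its class matters. *)
Lemma nquot_actE b x z : d z (L b (nrepr (nclass x))) = d z (L b x).
Proof. by rewrite -!L_adjoint nrepr_class. Qed.

(** Since the quotient form is definite, this also yields linearity of [nquot_act b] in the vector,
    via [mk_adjointable]. *)
Lemma nquot_act_adjoint b : is_adjoint (nquot_act b) (nquot_act b^*s).
Proof.
move=> q r; rewrite -[LHS]/(nquot_dot _ _) -[RHS]/(nquot_dot _ _).
by rewrite /nquot_dot nrepr_class -L_adjoint psdC nrepr_class -psdC.
Qed.

Definition nquot_rep_fun b : 'B(null_quot) := mk_adjointable (nquot_act_adjoint b).

Fact nquot_rep_linear : linear nquot_rep_fun.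
Proof.
move=> c a b; apply: adjointable_ext => q; apply: nquot_ext => z.
by rewrite /= !(nrepr_class, L_linear, psdDr, psdZr).
Qed.

HB.instance Definition _ := GRing.isLinear.Build C B 'B(null_quot) *:%R
  nquot_rep_fun nquot_rep_linear.

Fact nquot_repM : {morph nquot_rep_fun : a b / a ** b}.
Proof.
move=> a b; apply: adjointable_ext => q; apply: nquot_ext => z.
by rewrite /= !nrepr_class LM nquot_actE.
Qed.

Fact nquot_repS : {morph nquot_rep_fun : a / a^*s}.
Proof. by move=> a; apply/esym/adj_star_uniq; exact: nquot_act_adjoint. Qed.

Definition nquot_rep : starRep B null_quot :=
  @StarHom _ _ 'B(null_quot) nquot_rep_fun nquot_repM nquot_repS.

Lemma nquot_rep_eq0 b : nquot_rep b = 0 <-> forall x y, d x (L b y) = 0.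
Proof.
split=> [b0 x y|b0]; last first.
  by apply: adjointable_ext => q; apply: nquot_ext => z; rewrite !nrepr_class b0 psd0r.
have /(congr1 (fun u : 'B(null_quot) => u (nclass y))) /nclassP/(_ x) := b0.
by rewrite nquot_actE psd0r.
Qed.

End NullQuotient.

(** * Rieffel induction of representations along the bimodule *)

Section TensorRep.
Variables (R : realDomainType) (A B : starAlgType R) (X : bimodule B A).
Local Notation C := (cext R).

Lemma tensor_ind (V : leftModule A) (P : tensor (bimod_right X) V -> Prop) :
  P 0 -> (forall t u, P t -> P u -> P (t + u)) ->
  (forall x v, P (tens (X := bimod_right X) x v)) -> forall t, P t.
Proof.
move=> P0 PD Pt t; rewrite -(tens_reprK t) tens_classE.
by elim/big_ind: _ => // p _; exact: Pt.
Qed.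

Section LeftAction.
Variable V : leftModule A.
Local Notation XV := (tensor (bimod_right X) V).
Local Notation tens := (@tens R A (bimod_right X) V).

(** Balancedness over [A] is the commutation of the two actions on [X]. *)
Fact tens_lact_balanced (b : B) :
  balanced (fun (x : bimod_right X) (v : V) => tens (b *>> (x : X)) v).
Proof.
have tb := tens_balanced (bimod_right X) V; have lP := bimod_lactP X.
split=> [x y v|x v w|c x v|c x v|x a v].
- by rewrite (lactDr lP) (balDl tb).
- exact: (balDr tb).
- by rewrite (lactZr lP) (balZl tb).
- exact: (balZr tb).
- by rewrite -(balA tb) /= bimod_actA.
Qed.

Definition tens_lact (b : B) : XV -> XV :=
  tensor_lift (fun (x : bimod_right X) v => tens (b *>> (x : X)) v).

Lemma tens_lact_linear b : linear (tens_lact b).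
Proof. exact: tensor_lift_linear (tens_lact_balanced b). Qed.

Lemma tens_lactDr b t u : tens_lact b (t + u) = tens_lact b t + tens_lact b u.
Proof. by have := tens_lact_linear b 1 t u; rewrite !scale1r. Qed.

Lemma tens_lact0 b : tens_lact b 0 = 0.
Proof. by apply: (addrI (tens_lact b 0)); rewrite -tens_lactDr !addr0. Qed.

Lemma tens_lact_tens b (x : X) v : tens_lact b (tens x v) = tens (b *>> x) v.
Proof. exact: (tensor_lift_tens (tens_lact_balanced b)). Qed.

Lemma tens_lact_linearl c a b t :
  tens_lact (c *: a + b) t = c *: tens_lact a t + tens_lact b t.
Proof.
have tb := tens_balanced (bimod_right X) V; have lP := bimod_lactP X.
elim/tensor_ind: t => [|t u IHt IHu|x v].
- by rewrite !tens_lact0 scaler0 addr0.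
- by rewrite !tens_lactDr IHt IHu scalerDr addrACA.
- by rewrite !tens_lact_tens (lactDl lP) (lactZl lP) (balDl tb) (balZl tb).
Qed.

Lemma tens_lactM a b t : tens_lact (a ** b) t = tens_lact a (tens_lact b t).
Proof.
elim/tensor_ind: t => [|t u IHt IHu|x v].
- by rewrite !tens_lact0.
- by rewrite !tens_lactDr IHt IHu.
- by rewrite !tens_lact_tens (lactA (bimod_lactP X)).
Qed.

End LeftAction.

Variable ipA : X -> X -> A.
Hypotheses (ipP : right_inner_product (X := bimod_right X) ipA)
  (ip_adj : forall b x y, ipA (b *>> x) y = ipA x (b^*s *>> y))
  (ip_P : propertyP (X := bimod_right X) ipA).

Section Induced.
Variables (H : preHilbertType R) (pi : starRep A H).

(** Property P is exactly the positivity field. *)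
Definition induced_form : psd_form (tensor (bimod_right X) (rep_module pi)) :=
  PsdForm (@induced_dotDr _ _ _ _ _ pi ipP) (@induced_dotZr _ _ _ _ _ pi ipP)
    (@induced_dotC _ _ _ _ _ pi ipP) (@ip_P H pi).

Lemma induced_form_adjoint b t u :
  induced_form (tens_lact b^*s t) u = induced_form t (tens_lact b u).
Proof.
elim/tensor_ind: t u => [|t t' IHt IHt'|x v] u.
- by rewrite tens_lact0 psdC psd0r psdC psd0r.
- by rewrite tens_lactDr !psdDl IHt IHt'.
elim/tensor_ind: u => [|u u' IHu IHu'|y w].
- by rewrite tens_lact0 !psd0r.
- by rewrite tens_lactDr !psdDr IHu IHu'.
- by rewrite !tens_lact_tens /= !induced_dot_tens// ip_adj starK.
Qed.

Definition induced_rep : starRep B (null_quot induced_form) :=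
  nquot_rep (@tens_lact_linearl _) (@tens_lactM _) induced_form_adjoint.

(** The matrix coefficients of [b] at elementary tensors are [hdot v (pi (ipA x (b *>> y)) w)].
    Letting [v] and [w] vary, their vanishing says that [pi] kills [ipA x (b *>> y)]; sums of
    elementary tensors give nothing new. *)
Lemma induced_rep_ker :
  [set b | induced_rep b = 0] = Phi ipA [set a | pi a = 0].
Proof.
have rep0 b := nquot_rep_eq0 (@tens_lact_linearl _) (@tens_lactM _)
  induced_form_adjoint b.
apply/seteqP; split=> b /=.
  move=> /rep0 b0 x y /=.
  apply: adjointable_ext => w; apply: hdot_injr => v /=.
  have := b0 (tens (X := bimod_right X) (V := rep_module pi) x v)
             (tens (X := bimod_right X) (V := rep_module pi) y w).
  by rewrite tens_lact_tens /= induced_dot_tens// hdot0r.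
move=> b0; apply/rep0 => t u.
elim/tensor_ind: t u => [|t t' IHt IHt'|x v] u.
- by rewrite psdC psd0r rmorph0.
- by rewrite psdDl IHt IHt' addr0.
elim/tensor_ind: u => [|u u' IHu IHu'|y w].
- by rewrite tens_lact0 psd0r.
- by rewrite tens_lactDr psdDr IHu IHu' addr0.
- by rewrite tens_lact_tens /= induced_dot_tens// b0 /= hdot0r.
Qed.

End Induced.

Lemma Phi_closed I : closed_star_ideal I -> closed_star_ideal (Phi ipA I).
Proof.
move=> [H [pi ->]]; exists (null_quot (induced_form pi)), (induced_rep pi).
by rewrite induced_rep_ker.
Qed.

Definition ci_Phi (I : closedIdeal A) : closedIdeal B :=
  ClosedIdeal (Phi_closed (ci_closed I)).

Lemma ci_Phi_le : {homo ci_Phi : I J / (I <= J)%O}.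
Proof.
by move=> I J; rewrite !ci_leE => /asboolP IJ; apply/asboolP => b bI x y; exact/IJ/bI.
Qed.

End TensorRep.

(** * Algebraic properties of closed ideals *)

Section ClosedIdeals.
Variables (R : realDomainType) (A : starAlgType R).

(** The square length of [pi a x] is the pairing of [pi (a^*s ** a) x] with [x], and the product on
    [H] is definite. *)
Lemma starRep_eq0 (H : preHilbertType R) (pi : starRep A H) a :
  pi (a^*s ** a) = 0 -> pi a = 0.
Proof.
move=> a0; apply: adjointable_ext => x; apply: hdot_eq0.
transitivity (hdot (pi a^*s (pi a x)) x); first by rewrite shomS adj_starP.
have /(congr1 (fun u : 'B(H) => u x)) := a0.
by rewrite shomM /= => ->; rewrite hdot0l.
Qed.

Lemma star0 : 0^*s = 0 :> A.
Proof. by apply: (addrI 0^*s); rewrite -starD !addr0. Qed.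

Variables (I : set A) (Icl : closed_star_ideal I).

Lemma closed_ideal0 : I 0.
Proof. by have [H [pi ->]] := Icl; rewrite /= linear0. Qed.

Lemma closed_idealD a b : I a -> I b -> I (a + b).
Proof. by have [H [pi ->]] := Icl; rewrite /= linearD => -> ->; rewrite addr0. Qed.

Lemma closed_idealZ c a : I a -> I (c *: a).
Proof. by have [H [pi ->]] := Icl; rewrite /= linearZ => /= ->; rewrite scaler0. Qed.

Lemma closed_idealMlr c a d : I a -> I (c ** a ** d).
Proof.
have [H [pi ->]] := Icl => /= a0; rewrite !shomM a0.
by apply: adjointable_ext => x /=; rewrite adjointable0.
Qed.

(* [c = a a^*] and [d = a^*] make [c a d] the square of [a a^*].                *)
Lemma closed_ideal_prime a : (forall c d, I (c ** a ** d)) -> I a.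
Proof.
have [H [pi ->]] := Icl => /= Ia; rewrite -[a]starK shomS.
have -> : pi a^*s = 0; last by rewrite -[0 in LHS](linear0 pi) -shomS star0 linear0.
apply: starRep_eq0; rewrite starK; apply: starRep_eq0.
by rewrite starM starK smulA Ia.
Qed.

End ClosedIdeals.

Lemma cspan_full_ind (R : realDomainType) (V : lmodType (cext R)) (S P : set V) :
  cspan S = setT -> P 0 -> (forall v w, P v -> P w -> P (v + w)) ->
  (forall c v, P v -> P (c *: v)) -> S `<=` P -> forall v, P v.
Proof.
move=> fullS P0 PD PZ SP v; have : cspan S v by rewrite fullS.
case=> s sS ->; rewrite big_seq; elim/big_ind: _ => // p ps.
by apply/PZ/SP/sS.
Qed.

(** For fixed [a] the condition is linear in [c] and in [d] separately, so a spanning set of outer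
    factors suffices for [closed_ideal_prime]. *)
Lemma closed_ideal_full (R : realDomainType) (A : starAlgType R) (S I : set A) a :
  cspan S = setT -> closed_star_ideal I ->
  (forall c d, S c -> S d -> I (c ** a ** d)) -> I a.
Proof.
move=> fullS Icl SI; have I0 := closed_ideal0 Icl.
have smul0l b : 0 ** b = 0 :> A by apply: (addrI (0 ** b)); rewrite -smulDl !addr0.
have smul0r b : b ** 0 = 0 :> A by apply: (addrI (b ** 0)); rewrite -smulDr !addr0.
apply: (closed_ideal_prime Icl) => c d; move: c.
apply: (@cspan_full_ind _ _ _ (fun c => I (c ** a ** d)) fullS)
  => [|c c' Ic Ic'|z c Ic|c Sc].
- by rewrite !smul0l.
- by rewrite !smulDl; exact: (closed_idealD Icl).
- by rewrite !smulZl; exact: (closed_idealZ Icl).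
move: d; apply: (@cspan_full_ind _ _ _ (fun d => I (c ** a ** d)) fullS)
  => [|d d' Id Id'|z d Id|d Sd].
- by rewrite smul0r.
- by rewrite smulDr; exact: (closed_idealD Icl).
- by rewrite smulZr; exact: (closed_idealZ Icl).
- exact: SI.
Qed.

(** * The two transforms are mutually inverse *)

Section PhiInverse.
Variables (R : realDomainType) (A B : starAlgType R) (X : bimodule B A).
Variables (ipA : X -> X -> A) (ipB : X -> X -> B).
Hypothesis hX : equivalence_bimodule ipA ipB.

(** Together with [conj_ip_adjoint] and property Q, this lets the induction construction run on the
    conjugate bimodule and produce the map back from [B] to [A]. *)
Lemma conj_right_inner_product :
  right_inner_product (X := bimod_right (conj_bimodule X)) (conj_ip ipB).
Proof.
have ipBP := eqv_ipB hX; rewrite /conj_ip; split=> [x y z|c x y|x y b|x y].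
- by rewrite !(lipC ipBP x) (lipDl ipBP) starD.
- by rewrite !(lipC ipBP x) (lipZl ipBP) starZ cconjK.
- by rewrite !(lipC ipBP x) (lipAl ipBP) starM starK.
- exact: (lipC ipBP).
Qed.

Lemma conj_ip_adjoint (a : A) (x y : conj_bimodule X) :
  conj_ip ipB (a *>> x) y = conj_ip ipB x (a^*s *>> y).
Proof. exact: (eqv_adjB hX). Qed.

(** The left side is what membership of [a] in the double transform tests. Compatibility replaces
    the [ipB] factor by right multiplication with [ipA (y <<* a^*s) v], out of which [a] comes on
    the left. *)
Lemma ipA_ipB u x y a v :
  ipA u (ipB x (y <<* a^*s) *>> v) = ipA u x ** a ** ipA y v.
Proof.
have ipAP := eqv_ipA hX.
rewrite -(eqv_compat hX) (ripAr ipAP) -smulA; congr (_ ** _).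
by rewrite (ripC ipAP) (ripAr ipAP) starM starK -(ripC ipAP).
Qed.

(** Counterpart of [ipA_ipB] for the double transform starting from [B]. *)
Lemma ipB_ipA u v x b y :
  ipB u (v <<* (ipA x (b *>> y))^*s) = ipB u x ** b ** ipB y v.
Proof.
have ipAP := eqv_ipA hX; have ipBP := eqv_ipB hX.
rewrite -(ripC ipAP) (eqv_compat hX) (lipC ipBP) (lipAl ipBP) starM.
by rewrite -!(lipC ipBP) (lipAl ipBP) smulA.
Qed.

(** One inclusion cancels the outer factors of [ipA_ipB] by fullness of [ipA]; the other holds
    because a closed ideal is two-sided. *)
Lemma Phi_conjK (I : set A) : closed_star_ideal I ->
  Phi (conj_ip ipB) (Phi ipA I) = I.
Proof.
move=> Icl; apply/seteqP; split=> a aI.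
  apply: (closed_ideal_full (eqv_fullA hX) Icl) => _ _ [u _ [x _ <-]] [y _ [v _ <-]].
  by rewrite -ipA_ipB; exact: aI.
by move=> x y u v; rewrite ipA_ipB; exact: closed_idealMlr.
Qed.

Lemma conj_PhiK (J : set B) : closed_star_ideal J ->
  Phi ipA (Phi (conj_ip ipB) J) = J.
Proof.
move=> Jcl; apply/seteqP; split=> b bJ.
  apply: (closed_ideal_full (eqv_fullB hX) Jcl) => _ _ [u _ [x _ <-]] [y _ [v _ <-]].
  by rewrite -ipB_ipA; exact: bJ.
by move=> x y u v; rewrite /conj_ip [X in J X]ipB_ipA; exact: closed_idealMlr.
Qed.

End PhiInverse.

(** * Monotone inverse bijections of lattices *)

Section OrderIsomorphism.
Variables (d d' : Order.disp_t) (L : latticeType d) (L' : latticeType d').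
Variables (f : L -> L') (g : L' -> L).
Hypotheses (f_homo : {homo f : x y / (x <= y)%O})
  (g_homo : {homo g : x y / (x <= y)%O}) (fK : cancel f g) (gK : cancel g f).

Lemma homo_cancel_meet : {morph f : x y / Order.meet x y}.
Proof.
move=> x y; apply/le_anti; rewrite lexI !f_homo ?leIl ?leIr//=.
(* For the remaining inequality, the meet of [f x] and [f y] is written as [f] of its image under
   [g], and that image lies below both [x] and [y]. *)
rewrite -[leLHS]gK f_homo// lexI.
rewrite -[X in _ && (_ <= X)%O]fK -[X in (_ <= X)%O && _]fK.
by rewrite !g_homo ?leIl ?leIr.
Qed.

Lemma homo_cancel_join : {morph f : x y / Order.join x y}.
Proof.
move=> x y; apply/le_anti; rewrite leUx !f_homo ?leUl ?leUr// !andbT.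
(* Dually, the image under [g] of the join of [f x] and [f y] lies above both [x] and [y]. *)
rewrite -[leRHS]gK f_homo// leUx.
rewrite -[X in _ && (X <= _)%O]fK -[X in (X <= _)%O && _]fK.
by rewrite !g_homo ?leUl ?leUr.
Qed.

End OrderIsomorphism.

Theorem theorem5p4 (R : realDomainType) (A B : starAlgType R)
    (hA : idempotent_alg A) (hB : idempotent_alg B)
    (X : bimodule B A) (ipA : X -> X -> A) (ipB : X -> X -> B)
    (hX : equivalence_bimodule ipA ipB) :
  exists (f : closedIdeal A -> closedIdeal B)
         (g : closedIdeal B -> closedIdeal A),
    [/\ forall I : closedIdeal A, f I = Phi ipA I :> set B,
        forall J : closedIdeal B, g J = Phi (conj_ip ipB) J :> set A,
        cancel f g & cancel g f]
    /\ [/\ {morph f : I J / Order.meet I J},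
           {morph f : I J / Order.join I J},
           {morph g : I J / Order.meet I J}
         & {morph g : I J / Order.join I J}].
Proof.
pose f := ci_Phi (eqv_ipA hX) (eqv_adjA hX) (eqv_P hX).
pose g := ci_Phi (conj_right_inner_product hX) (conj_ip_adjoint hX) (eqv_Q hX).
have fK : cancel f g.
  by move=> I; apply: closedIdeal_ext; exact: (Phi_conjK hX (ci_closed I)).
have gK : cancel g f.
  by move=> J; apply: closedIdeal_ext; exact: (conj_PhiK hX (ci_closed J)).
have fh : {homo f : I J / (I <= J)%O} by exact: ci_Phi_le.
have gh : {homo g : I J / (I <= J)%O} by exact: ci_Phi_le.
exists f, g; split; split=> //.
- exact: homo_cancel_meet gh fK gK.
- exact: homo_cancel_join gh fK gK.
- exact: homo_cancel_meet fh gK fK.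
- exact: homo_cancel_join fh gK fK.
Qed.
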